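(* There exists a family of cardinality $c$ consisting of infinite and discrete subsets of the unit interval $[0,1]$ such that any two distinct members of the family are metrically distinct.
   Context: $c$ denotes the cardinality of $\mathbb{R}$. A set $X \subset \mathbb{R}$ is discrete if for every $x \in X$ the singleton $\{x\}$ is open in the subspace $X$ of $\mathbb{R}$ (so $X$ need not be closed in $\mathbb{R}$). Subsets of $\mathbb{R}$ are equipped with the inherited Euclidean metric. Two sets $X, Y$ are metrically similar if there is a bijection $f$ from $X$ onto $Y$ such that both $f$ and $f^{-1}$ are uniformly continuous; otherwise they are metrically distinct. *)

(* Defs.v *)
From mathcomp Require Import all_boot all_order all_algebra.
From mathcomp Require Import all_classical all_reals all_analysis.
Import Order.TTheory GRing.Theory Num.Theory.
Import numFieldNormedType.Exports.

Set Implicit Arguments.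
Unset Strict Implicit.
Unset Printing Implicit Defensive.

Local Open Scope classical_set_scope.
Local Open Scope ring_scope.

(* Below, a set [X] used as a type is [set_type X], whose topology and uniform
   structure are the ones induced by the inclusion into the real line. Unlike
   [subspace X], it has no points outside [X]. *)

Definition discrete_subset (R : realType) (X : set R) : Prop :=
  forall x : X, open [set x].

Definition metrically_similar (R : realType) (X Y : set R) : Prop :=
  exists (f : X -> Y) (g : Y -> X),
    [/\ cancel f g, cancel g f, unif_continuous f & unif_continuous g].

Definition metrically_distinct (R : realType) (X Y : set R) : Prop :=
  ~ metrically_similar X Y.

(* Main.v *)
(** A uniform homeomorphism extends to the closures, so it preserves the
    Cantor-Bendixson ranks of the closure of a discrete set. These ranks are
    expressed in terms of the algebra of uniformly clopen subsets U of X alone: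
    the k-th derivative of the closure of U is nonempty iff U contains, for k > 0,
    infinitely many disjoint uniformly clopen sets whose (k-1)-st derivative is
    nonempty. Call n critical when some U has a nonempty perfect (n+1)-st
    derivative while the isolated points of its n-th derivative are dense in that
    derivative. Scattered pieces have no critical rank, whereas attaching a piece
    of rank n in every gap of a Cantor set makes n critical. For each a : nat ->
    bool, a sequence of blocks of the latter kind of ranks 2 m + a m yields a
    discrete set whose critical ranks are exactly these numbers, hence
    determine a; a real number is in turn determined by its cut in the rationals. *)
Require Import Defs.
From mathcomp Require Import all_boot all_order all_algebra.
From mathcomp Require Import all_classical all_reals all_analysis.
From mathcomp Require Import lra zify.
Import Order.TTheory GRing.Theory Num.Theory.
Import numFieldNormedType.Exports.

Set Implicit Arguments.
Unset Strict Implicit.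
Unset Printing Implicit Defensive.

Local Open Scope classical_set_scope.

(** * Cantor-Bendixson rank relative to an abstract family of clopen sets *)

Section Rank.
Context {T : Type} (B : set (set T)).

Fixpoint rank_ge k (U : set T) : Prop :=
  if k is k'.+1 then
    exists V : nat -> set T,
      [/\ forall i, B (V i), forall i, V i `<=` U,
          forall i j x, V i x -> V j x -> i = j & forall i, rank_ge k' (V i)]
  else U !=set0.

(** The third clause makes the derivative of order [n+1] perfect. In the last one, the [n]-th
    derivative of [V'] is nonempty and finite, so [V] contains isolated points of the [n]-th
    derivative of [U]. *)
Definition critical_rank n : Prop :=
  exists U, [/\ B U, rank_ge n.+1 U,
    forall V, B V -> V `<=` U -> rank_ge n.+1 V -> rank_ge n.+2 V &
    forall V, B V -> V `<=` U -> rank_ge n V ->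
      exists V', [/\ B V', V' `<=` V, rank_ge n V' & ~ rank_ge n.+1 V']].

Lemma rank_ge_sub k U V : U `<=` V -> rank_ge k U -> rank_ge k V.
Proof.
case: k => [|k] UV /=; first by case=> x Ux; exists x; apply: UV.
by case=> W [BW WU dW kW]; exists W; split=> // i; apply: subset_trans UV.
Qed.

Lemma rank_ge_leq j k U : j <= k -> rank_ge k U -> rank_ge j U.
Proof.
move=> /subnK <-; elim: (k - j) U => [//|d IH] U /= [V [_ VU _ kV]].
exact: IH (rank_ge_sub (VU 0) (kV 0)).
Qed.

Lemma rank_ge_neq0 k U : rank_ge k U -> U !=set0.
Proof. exact: (@rank_ge_leq 0). Qed.

Hypothesis BI : forall U V, B U -> B V -> B (U `&` V).

(** Pigeonhole: among the pieces of the union, either cofinitely many keep rank [k] after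
    intersection with [V], or infinitely many do with [U]. *)
Lemma rank_geU k U V : B U -> B V ->
  rank_ge k (U `|` V) -> rank_ge k U \/ rank_ge k V.
Proof.
elim: k U V => [|k IH] U V BU BV /=.
  by case=> x [Ux|Vx]; [left|right]; exists x.
move=> [W [BW WUV dW kW]].
have WE i : rank_ge k (W i `&` U) \/ rank_ge k (W i `&` V).
  by apply: IH; [exact: BI..|rewrite -setIUr setIidl].
have [[N NV]|infU] := pselect (exists N, forall i, N <= i -> rank_ge k (W i `&` V)).
  right; exists (fun i => W (N + i) `&` V); split.
  - by move=> i; apply: BI.
  - by move=> i x [].
  - by move=> i j x [Wi _] [Wj _]; apply/(@addnI N)/(dW _ _ x).
  - by move=> i; apply/NV/leq_addr.
have /choice[f fP] N : exists i, N <= i /\ rank_ge k (W i `&` U).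
  apply: contrapT => fN; apply: infU; exists N => i Ni.
  by case: (WE i) => // WU; case: fN; exists i.
(* Strictly increasing choice of indices, so that the selected pieces remain disjoint. *)
pose s := fix s n := f (if n is n'.+1 then (s n').+1 else 0).
have smono : {homo s : i j / i < j}.
  by apply: homo_ltn => [? ? ?|i /=]; [exact: ltn_trans|case: (fP (s i).+1)].
left; exists (fun i => W (s i) `&` U); split.
- by move=> i; apply: BI.
- by move=> i x [].
- move=> i j x [Wi _] [Wj _]; have /esym/eqP := dW _ _ _ Wi Wj.
  by have [/smono|/smono|//] := ltngtP i j; lia.
- by case=> [|i] /=; [case: (fP 0)|case: (fP (s i).+1)].
Qed.

End Rank.

(** * Invariance of critical ranks *)

Section Transfer.
Context {T T' : Type} (B : set (set T)) (B' : set (set T')) (f : T -> T').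
Hypothesis finj : injective f.
Hypothesis BB' : forall U, B U -> B' (f @` U).
Hypothesis B'B : forall V, B' V -> B (f @^-1` V).
Hypothesis Brange : forall V, B' V -> V `<=` range f.

Lemma rank_ge_image k U : rank_ge B k U -> rank_ge B' k (f @` U).
Proof.
elim: k U => [|k IH] U /=; first by case=> x Ux; exists (f x), x.
move=> [V [BV VU dV kV]]; exists (fun i => f @` V i); split=> [i|i|i j _ [x Vx <-] [y Vy]|i].
- exact: BB'.
- exact: image_subset.
- by move/finj => yx; apply: (dV _ _ x) => //; rewrite -yx.
- exact: IH.
Qed.

Lemma rank_ge_preimage k V : B' V -> rank_ge B' k V -> rank_ge B k (f @^-1` V).
Proof.
elim: k V => [|k IH] V B'V /=.
  by case=> y Vy; have [x _ xy] := Brange B'V Vy; exists x; rewrite /preimage /= xy.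
case=> W [BW WV dW kW]; exists (fun i => f @^-1` W i); split=> [i|i|i j x|i].
- exact: B'B.
- exact: preimage_subset.
- exact: dW.
- exact: IH.
Qed.

Let preimage_imageK U : f @^-1` (f @` U) = U.
Proof.
by apply/seteqP; split=> x; [case=> y Uy /finj <-|move=> Ux; exists x].
Qed.

Let image_preimageK V : B' V -> f @` (f @^-1` V) = V.
Proof.
move=> /Brange Vr; apply/seteqP; split=> [_ [x Vfx <-] //|y Vy].
by have [x _ xy] := Vr y Vy; exists x; rewrite // /preimage /= xy.
Qed.

(** Image and preimage are inverse bijections between [B] and [B']. Only members of [B'] must lie in
    the range of [f], because decoding maps points into the type of all words but hits only the
    accepted ones. *)
Lemma critical_rank_transfer n : critical_rank B n <-> critical_rank B' n.
Proof.
have imageE k U : B U -> rank_ge B' k (f @` U) <-> rank_ge B k U.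
  split; last exact: rank_ge_image.
  by move/rank_ge_preimage; rewrite preimage_imageK; apply; apply: BB'.
have preimageE k V : B' V -> rank_ge B k (f @^-1` V) <-> rank_ge B' k V.
  split; last exact: rank_ge_preimage.
  by move/rank_ge_image; rewrite image_preimageK.
split=> -[U [BU kU Uiso Udense]].
- exists (f @` U); split=> [||V B'V VU /preimageE kV|V B'V VU /preimageE kV].
  + exact: BB'.
  + exact/imageE.
  + apply/preimageE => //; apply: Uiso; [exact: B'B| |exact: kV].
    by rewrite -[U]preimage_imageK; apply: preimage_subset.
  + have [|V' [BV' V'V kV' nkV']] := Udense _ (B'B B'V) _ (kV B'V).
      by rewrite -[U]preimage_imageK; apply: preimage_subset.
    exists (f @` V'); split; [exact: BB'| |exact/imageE|by move/imageE => /(_ BV')].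
    by rewrite -(image_preimageK B'V); apply: image_subset.
- exists (f @^-1` U); split=> [||V BV VU /imageE kV|V BV VU /imageE kV].
  + exact: B'B.
  + exact/preimageE.
  + apply/imageE => //; apply: Uiso; [exact: BB'| |exact: kV].
    by rewrite -(image_preimageK BU); apply: image_subset.
  + have [|V' [BV' V'V kV' nkV']] := Udense _ (BB' BV) _ (kV BV).
      by rewrite -(image_preimageK BU); apply: image_subset.
    exists (f @^-1` V'); split;
      [exact: B'B| |exact/preimageE|by move/preimageE => /(_ BV')].
    by rewrite -[V]preimage_imageK; apply: preimage_subset.
Qed.

End Transfer.

(** * The automaton and its reachable states *)

Local Notation word := (seq (option bool)).
Local Notation zero := (Some false).
Local Notation one := None.
Local Notation two := (Some true).

(* Points are the words leading the automaton from [Spine 0] to [Scattered 0],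
   where it stops. The words accepted from [Scattered j] form a set of rank [j],
   accumulating at the words with fewer than [j] letters [one] continued by
   infinitely many [zero]. From [Perfect n], the infinite words in [zero] and
   [two] form a Cantor set, and each [one] opens a piece of rank [n]. *)
Variant state := Scattered of nat | Perfect of nat | Spine of nat.

Section Automaton.
Variable a : nat -> bool.

Definition step s (l : option bool) : option state :=
  match s, l with
  | Scattered j.+1, zero => Some (Scattered j.+1)
  | Scattered j.+1, one => Some (Scattered j)
  | Perfect n, Some _ => Some (Perfect n)
  | Perfect n, one => Some (Scattered n)
  | Spine m, zero => Some (Spine m.+1)
  | Spine m, one => Some (Perfect (m.*2 + a m))
  | _, _ => None
  end.

Fixpoint run s (w : word) : option state :=
  if w is l :: w' then obind (run^~ w') (step s l) else Some s.

Lemma run_cat s u v : run s (u ++ v) = obind (run^~ v) (run s u).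
Proof. by elim: u s => //= l u IH s; case: (step s l) => /=. Qed.

Lemma run_catS s t u v : run s u = Some t -> run s (u ++ v) = run t v.
Proof. by rewrite run_cat => ->. Qed.

Lemma run_Scattered_zeros j i :
  run (Scattered j.+1) (nseq i zero) = Some (Scattered j.+1).
Proof. by elim: i. Qed.

Lemma run_Perfect_zeros n i : run (Perfect n) (nseq i zero) = Some (Perfect n).
Proof. by elim: i. Qed.

Lemma run_Spine_zeros m i : run (Spine m) (nseq i zero) = Some (Spine (m + i)).
Proof. by elim: i m => [|i IH] m /=; rewrite ?addn0 // IH addSnnS. Qed.

Definition reaches s t := exists v, run s v = Some t.

Lemma reaches_trans t s r : reaches s t -> reaches t r -> reaches s r.
Proof. by move=> [u su] [v tv]; exists (u ++ v); rewrite (run_catS _ su). Qed.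

Lemma Scattered_reaches i j : i <= j -> reaches (Scattered j) (Scattered i).
Proof.
move=> /subnK <-; elim: (j - i) => [|d IH]; first by exists [::].
by apply: reaches_trans IH; exists [:: one].
Qed.

Lemma Perfect_reaches i n : i <= n -> reaches (Perfect n) (Scattered i).
Proof.
by move/Scattered_reaches; apply: reaches_trans; exists [:: one].
Qed.

Lemma Spine_reaches i m : reaches (Spine m) (Scattered i).
Proof.
(* After [i] more spine steps, the block on offer has rank at least [i]. *)
have : i <= (m + i).*2 + a (m + i) by lia.
move/Perfect_reaches; apply: reaches_trans.
by exists (nseq i zero ++ [:: one]); rewrite run_cat run_Spine_zeros.
Qed.

Lemma reaches_accept s : reaches s (Scattered 0).
Proof.
case: s => n; [exact: Scattered_reaches|exact: Perfect_reaches|exact: Spine_reaches].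
Qed.

Lemma run_Scattered j v s : run (Scattered j) v = Some s ->
  (exists2 i, i < j & s = Scattered i) \/
  (s = Scattered j /\ v = nseq (size v) zero).
Proof.
elim: v j => [|l v IH] j /=; first by case=> <-; right.
case: j => [|j] //; case: l => [[|]|] //= /IH.
  by case=> [[i ij ->]|[-> {1}->]]; [left; exists i|right].
by case=> [[i ij ->]|[-> _]]; left; [exists i => //; exact: ltnW|exists j].
Qed.

Lemma run_Perfect n v s : run (Perfect n) v = Some s ->
  s = Perfect n \/ exists2 j, j <= n & s = Scattered j.
Proof.
elim: v => [|l v IH] /=; first by case=> <-; left.
case: l => [b|] //= /run_Scattered [[i ij ->]|[-> _]]; right.
  by exists i => //; exact: ltnW.
by exists n.
Qed.

(** A block opened at position [k] of the spine has rank [2 k + a k], whose half is [k] and whose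
    parity is [a k]. *)
Lemma run_Spine_Perfect m v n :
  run (Spine m) v = Some (Perfect n) -> nat_of_bool (odd n) = a n./2.
Proof.
elim: v m => [|l v IH] m //=; case: l => [[]|] //=; first exact: IH.
move/run_Perfect => [|[j _ //]] [->].
rewrite oddD odd_double oddb /=; congr (nat_of_bool (a _)).
by case: (a m); lia.
Qed.

(** * Cylinders and uniformly clopen sets of accepted words *)

Definition accepted : set word := [set w | run (Spine 0) w = Some (Scattered 0)].

(** No letter leaves [Scattered 0]. This prefix-freeness is what isolates every point. *)
Lemma accepted_prefix u v : accepted u -> accepted (u ++ v) -> v = [::].
Proof. by rewrite /accepted /= run_cat => -> /=; case: v => [|[]]. Qed.

Definition cylinder (u : word) : set word := [set w | accepted w /\ prefix u w].

(** A single prefix length [N] serves all words: this is the uniform notion, not the topological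
    one. *)
Definition clopen (U : set word) : Prop := U `<=` accepted /\
  exists N, forall w w', U w -> accepted w' -> take N w = take N w' -> U w'.

Lemma cylinder_cat u v : cylinder (u ++ v) `<=` cylinder u.
Proof.
move=> w [aw /prefixP[s ws]]; split=> //.
by apply/prefixP; exists (v ++ s); rewrite catA.
Qed.

Lemma branch_inj u l i i' w : l != zero ->
  cylinder (u ++ nseq i zero ++ [:: l]) w ->
  cylinder (u ++ nseq i' zero ++ [:: l]) w -> i = i'.
Proof.
move=> l0 [_ /prefixP[s ->]] [_ /prefixP[s']].
rewrite -!catA => /eqP; rewrite eqseq_cat // eqxx /= => /eqP.
elim: i i' => [|i IH] [|i'] //=; last by case=> /IH ->.
  by case=> l0'; rewrite l0' eqxx in l0.
by case=> l0'; rewrite -l0' eqxx in l0.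
Qed.

Lemma cylinder_clopen u : clopen (cylinder u).
Proof.
split=> [w []//|]; exists (size u) => w w' [_ uw] aw' ww'; split=> //.
by move: uw; rewrite !prefixE ww'.
Qed.

Lemma clopenI U V : clopen U -> clopen V -> clopen (U `&` V).
Proof.
move=> [UL [N NU]] [VL [M MV]]; split=> [w [/UL]//|].
exists (maxn N M) => w w' [Uw Vw] aw' ww'.
have ww'K K : K <= maxn N M -> take K w = take K w'.
  by move=> KNM; rewrite -(take_takel w KNM) ww' take_takel.
by split; [apply: NU (ww'K _ _)|apply: MV (ww'K _ _)]; rewrite // leq_max leqnn ?orbT.
Qed.

Lemma cylinder_accepted u w : accepted u -> cylinder u w -> w = u.
Proof.
move=> au [aw /prefixP[s ws]]; rewrite ws in aw *.
by rewrite (accepted_prefix au aw) cats0.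
Qed.

Lemma cylinder_split u : ~ accepted u -> cylinder u `<=`
  cylinder (rcons u zero) `|` (cylinder (rcons u one) `|` cylinder (rcons u two)).
Proof.
move=> nau w [aw /prefixP[s ws]]; case: s ws => [|l s] ws.
  by case: nau; rewrite cats0 in ws; rewrite -ws.
have lP : cylinder (rcons u l) w.
  by split=> //; apply/prefixP; exists s; rewrite cat_rcons.
by case: l lP {ws} => [[]|]; [right; right|left|right; left].
Qed.

(* A clopen set is a finite union of cylinders, one of which must carry the rank. *)
Lemma rank_ge_cylinder k u U : clopen U ->
  rank_ge clopen k (U `&` cylinder u) ->
  exists v, cylinder (u ++ v) `<=` U /\ rank_ge clopen k (cylinder (u ++ v)).
Proof.
move=> cU; have [UL [N NU]] := cU.
have [M] := ubnP (N - size u); elim: M u => // M IH u NM kUu.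
have [w [Uw uw]] := rank_ge_neq0 kUu.
have sub : cylinder u `<=` U -> exists v,
    cylinder (u ++ v) `<=` U /\ rank_ge clopen k (cylinder (u ++ v)).
  move=> uU; exists [::]; rewrite cats0; split=> //.
  by apply: rank_ge_sub kUu => x [].
(* From depth [N] on, a cylinder that meets [U] lies in [U]; above it, the rank passes to one of
   three children. *)
have [Nu|uN] := leqP N (size u).
  apply: sub => w' [aw' uw']; apply: NU Uw aw' _.
  have [_ /prefixP[s ->]] := uw; have /prefixP[s' ->] := uw'.
  by rewrite !takel_cat.
have [au|nau] := pselect (accepted u).
  apply: sub => w' /(cylinder_accepted au) ->.
  by rewrite -(cylinder_accepted au uw).
have child l : rank_ge clopen k (U `&` cylinder (rcons u l)) -> exists v,
    cylinder (u ++ v) `<=` U /\ rank_ge clopen k (cylinder (u ++ v)).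
  move=> /IH; rewrite size_rcons => -[|v [vU kv]]; first by lia.
  by exists (l :: v); rewrite -cat_rcons.
have Bc l : clopen (U `&` cylinder (rcons u l)).
  by apply: clopenI => //; apply: cylinder_clopen.
have BcU U1 U2 : clopen U1 -> clopen U2 -> clopen (U1 `|` U2).
  move=> [U1L [N1 NU1]] [U2L [N2 NU2]]; split=> [x [/U1L|/U2L]//|].
  exists (maxn N1 N2) => x x' Ux ax' xx'.
  have xx'K K : K <= maxn N1 N2 -> take K x = take K x'.
    by move=> KNM; rewrite -(take_takel x KNM) xx' take_takel.
  case: Ux => Ux; [left; apply: NU1 Ux ax' _|right; apply: NU2 Ux ax' _];
    by rewrite xx'K // leq_max leqnn ?orbT.
have : rank_ge clopen k (U `&` cylinder (rcons u zero) `|`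
    (U `&` cylinder (rcons u one) `|` U `&` cylinder (rcons u two))).
  apply: rank_ge_sub kUu => x [Ux /(cylinder_split nau)].
  by case=> [|[]]; [left|right; left|right; right].
move=> /(rank_geU clopenI (Bc _) (BcU _ _ (Bc _) (Bc _))) [/child//|].
by move=> /(rank_geU clopenI (Bc _) (Bc _)) [/child//|/child].
Qed.

Lemma cylinder_neq0 u : (exists s, run (Spine 0) u = Some s) <-> cylinder u !=set0.
Proof.
split=> [[s us]|[w [aw /prefixP[v wv]]]].
  have [v sv] := reaches_accept s; exists (u ++ v).
  by split; [rewrite /accepted /= (run_catS _ us)|exact: prefix_prefix].
move: aw; rewrite /accepted /= wv run_cat.
by case: (run _ u) => //= s _; exists s.
Qed.

(** * Ranks of cylinders and the critical ranks of the automaton *)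

Lemma rank_ge_Scattered j u : run (Spine 0) u = Some (Scattered j) ->
  rank_ge clopen j (cylinder u).
Proof.
elim: j u => [|j IH] u uj; first by apply/cylinder_neq0; exists (Scattered 0).
exists (fun i => cylinder (u ++ nseq i zero ++ [:: one])); split=> [i|i|i i' w|i].
- exact: cylinder_clopen.
- exact: cylinder_cat.
- exact: branch_inj.
- by apply: IH; rewrite (run_catS _ uj) run_cat run_Scattered_zeros.
Qed.

(** Reading zeros and then [two] returns to the same state, so these disjoint branches give every
    rank. *)
Lemma rank_ge_Perfect k n u : run (Spine 0) u = Some (Perfect n) ->
  rank_ge clopen k (cylinder u).
Proof.
elim: k u => [|k IH] u un; first by apply/cylinder_neq0; exists (Perfect n).
exists (fun i => cylinder (u ++ nseq i zero ++ [:: two])); split=> [i|i|i i' w|i].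
- exact: cylinder_clopen.
- exact: cylinder_cat.
- exact: branch_inj.
- by apply: IH; rewrite (run_catS _ un) run_cat run_Perfect_zeros.
Qed.

Lemma rank_ge_run k u U : clopen U -> U `<=` cylinder u -> rank_ge clopen k U ->
  exists v s, [/\ run (Spine 0) (u ++ v) = Some s, cylinder (u ++ v) `<=` U &
                  rank_ge clopen k (cylinder (u ++ v))].
Proof.
move=> cU Uu kU; have [|v [vU kv]] := @rank_ge_cylinder k u U cU.
  by rewrite setIidl.
by have /cylinder_neq0[s us] := rank_ge_neq0 kv; exists v, s.
Qed.

(** The only candidate of rank [j] is [u] continued by zeros forever ([u] itself if [j = 0]). One of
    two disjoint clopen sets avoids a neighbourhood of it, so its cylinders have already read a
    [one] and have smaller index. *)
Lemma rank_lt_Scattered j u : run (Spine 0) u = Some (Scattered j) ->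
  ~ rank_ge clopen j.+1 (cylinder u).
Proof.
elim/ltn_ind: j u => j IH u uj [V [cV Vu dV kV]].
case: j IH uj kV => [|j] IH uj kV.
  have [[x Vx] [y Vy]] := (kV 0, kV 1).
  have xu := cylinder_accepted uj (Vu _ _ Vx).
  have yu := cylinder_accepted uj (Vu _ _ Vy).
  by have := dV 0 1 u; rewrite -{1}xu -yu => /(_ Vx Vy).
have {}kV : forall i, rank_ge clopen j.+1 (V i) := kV.
have [[_ [N0 V0]] [_ [N1 V1]]] := (cV 0, cV 1).
pose N := maxn N0 N1; pose u0 := u ++ nseq N zero.
have takeu0 w K : K <= N -> cylinder u0 w -> take K w = take K u0.
  move=> KN [_ /prefixP[s ->]]; rewrite takel_cat // size_cat size_nseq.
  exact: leq_trans (leq_addl _ _).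
(* [V 0] and [V 1] are disjoint, so they cannot both meet the cylinder of [u0]. *)
have [i Viu0] : exists i, forall w, V i w -> ~ cylinder u0 w.
  apply: contrapT => nV.
  have meets i : exists w, V i w /\ cylinder u0 w.
    by apply: contrapT => ni; apply: nV; exists i => w Vw u0w; apply: ni; exists w.
  have [[w [Vw u0w]] [w' [Vw' u0w']]] := (meets 0, meets 1).
  have : V 0 w'.
    by apply: V0 Vw u0w'.1 _; rewrite !takeu0 // leq_maxl.
  by move=> /dV /(_ Vw').
have [v [s [us vV kv]]] := rank_ge_run (cV i) (Vu i) (kV i).
have := us; rewrite (run_catS _ uj) => /run_Scattered[[j' j'j sE]|[_ vE]].
  by rewrite sE in us; apply: (IH _ j'j _ us); apply: rank_ge_leq kv.
have [vN|Nv] := leqP (size v) N.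
  have [x xu0] : cylinder u0 !=set0.
    apply/cylinder_neq0; exists (Scattered j.+1).
    by rewrite (run_catS _ uj) run_Scattered_zeros.
  apply: (Viu0 x) => //; apply: vV; rewrite vE.
  apply: (@cylinder_cat _ (nseq (N - size v) zero)).
  by rewrite -catA -nseqD subnKC.
have [x xv] := rank_ge_neq0 kv.
apply: (Viu0 x); first exact: vV.
apply: (@cylinder_cat _ (nseq (size v - N) zero)).
by rewrite -catA -nseqD (subnKC (ltnW Nv)) -vE.
Qed.

(** Scattered cylinders below [u] have rank at most [m], so rank [m+1] forces a cylinder still in
    state [Perfect m]. *)
Lemma rank_ge_Perfect_sub m u V : run (Spine 0) u = Some (Perfect m) ->
  clopen V -> V `<=` cylinder u -> rank_ge clopen m.+1 V ->
  forall k, rank_ge clopen k V.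
Proof.
move=> um cV Vu mV k; have [v [s [us vV kv]]] := rank_ge_run cV Vu mV.
apply: rank_ge_sub vV _; have := us; rewrite (run_catS _ um).
move/run_Perfect => [|[j jm]] sE; rewrite sE in us.
  exact: rank_ge_Perfect us.
by case: (rank_lt_Scattered us); apply: rank_ge_leq kv.
Qed.

Lemma critical_rankE n : critical_rank clopen n <-> nat_of_bool (odd n) = a n./2.
Proof.
split=> [[U [cU nU Uiso Udense]]|an].
  have UL : U `<=` cylinder [::].
    by move=> w /(cU.1) aw; split=> //; exact: prefix0s.
  have [u [s [us uU nu]]] := rank_ge_run cU UL nU; rewrite cat0s in us uU nu.
  (* Such a state would give a piece of rank exactly [n+1], against perfectness. This leaves only
     [Perfect m] with [m <= n]. *)
  have nsW : ~ reaches s (Scattered n.+1).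
    move=> [v sv]; have uv : run (Spine 0) (u ++ v) = Some (Scattered n.+1).
      by rewrite (run_catS _ us).
    apply: (rank_lt_Scattered uv); apply: Uiso; first exact: cylinder_clopen.
      by apply: subset_trans uU; apply: cylinder_cat.
    exact: rank_ge_Scattered.
  case: s us nsW => [j|m|m] us nsW; last by case: nsW; apply: Spine_reaches.
    case: (rank_lt_Scattered us); apply: rank_ge_leq nu.
    by rewrite ltnS leqNgt; apply/negP => /Scattered_reaches/nsW.
  have mn : m <= n by rewrite leqNgt; apply/negP => /Perfect_reaches/nsW.
  case: ltngtP mn => // [mn _|mn _]; last first.
    by rewrite -mn; apply: run_Spine_Perfect us.
  (* If [m < n], a piece of rank [n] has all ranks, so none has rank exactly [n]. *)
  have [|V' [cV' V'u nV' nnV']] := Udense _ (cylinder_clopen u) uU.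
    exact: rank_ge_Perfect us.
  case: nnV'; apply: rank_ge_Perfect_sub us cV' V'u _ _.
  exact: rank_ge_leq nV'.
(* The word that opens the block of rank [n]. *)
pose u := rcons (nseq n./2 zero) one.
have un : run (Spine 0) u = Some (Perfect n).
  rewrite /u -cats1 run_cat run_Spine_zeros /= add0n -an addnC.
  by rewrite odd_double_half.
exists (cylinder u); split.
- exact: cylinder_clopen.
- exact: rank_ge_Perfect un.
- by move=> V cV Vu nV; apply: rank_ge_Perfect_sub un cV Vu nV _.
- move=> V cV Vu nV; have [v [s [us vV nv]]] := rank_ge_run cV Vu nV.
  have [w nw] : exists w, run (Spine 0) (u ++ v ++ w) = Some (Scattered n).
    have : reaches s (Scattered n).
      have := us; rewrite (run_catS _ un) => /run_Perfect[->|[j jn sE]].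
        exact: Perfect_reaches.
      rewrite sE in us *; apply: Scattered_reaches; rewrite leqNgt.
      apply/negP => nj; apply: (rank_lt_Scattered us).
      exact: rank_ge_leq nv.
    by move=> [w sw]; exists w; rewrite catA (run_catS _ us).
  exists (cylinder (u ++ v ++ w)); split.
  + exact: cylinder_clopen.
  + by apply: subset_trans vV; rewrite catA; apply: cylinder_cat.
  + exact: rank_ge_Scattered.
  + exact: rank_lt_Scattered.
Qed.

End Automaton.

Local Open Scope ring_scope.

(** * Coding words as points of the unit interval *)

Section Coding.
Context {R : realType}.

Definition digit (l : option bool) : nat :=
  match l with zero => 0 | one => 2 | two => 4 end.

(* Even digits in base 6: words with distinct first letters are at distance at
   least 1/6. *)
Fixpoint code (w : word) : R :=
  if w is l :: w' then ((digit l)%:R + code w') / 6 else 0.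

Lemma code_itv w : 0 <= code w <= 1.
Proof.
elim: w => [|l w IH] /=; first by lra.
have : 0 <= ((digit l)%:R : R) <= 4 by rewrite ler0n ler_nat; case: l => [[]|].
lra.
Qed.

Lemma dist_code_cons l w w' :
  `|code (l :: w) - code (l :: w')| = `|code w - code w'| / 6.
Proof.
by rewrite /= -mulrBl opprD addrACA subrr add0r normrM [X in _ * X]ger0_norm.
Qed.

Lemma code_take N w w' : take N w = take N w' -> `|code w - code w'| <= 6 ^- N.
Proof.
elim: N w w' => [|N IH] w w'.
  by rewrite expr0 invr1 ler_norml; have [] := (code_itv w, code_itv w'); lra.
case: w w' => [|l w] [|l' w'] //.
  by rewrite subrr normr0 invr_ge0 exprn_ge0.
by case=> <- /IH; rewrite dist_code_cons exprS invfM mulrC ler_pM2l // invr_gt0.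
Qed.

Variable a : nat -> bool.

(** Converse to [code_take]: prefix agreement and distance define the same uniformity. Trailing
    zeros do not change [code], hence the acceptance hypotheses; the common state [s] is general for
    the induction. *)
Lemma code_separated N s w w' :
  run a s w = Some (Scattered 0) -> run a s w' = Some (Scattered 0) ->
  `|code w - code w'| < 6 ^- N -> take N w = take N w'.
Proof.
elim: N s w w' => [|N IH] s w w'; first by rewrite !take0.
case: w w' => [|l w] [|l' w'] // sw sw'.
- by move: sw sw' => [->] /=; case: l'.
- by move: sw' sw => [->] /=; case: l.
have [ll'|ll'] := eqVneq l l'.
  rewrite -{}ll' in sw' *.
  rewrite dist_code_cons exprS invfM mulrC ltr_pM2l // => ww'; congr (_ :: _).
  move: sw sw' => /=; case: (step a s l) => //= t sw sw'.
  exact: IH sw sw' ww'.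
have far : 6^-1 <= `|code (l :: w) - code (l' :: w')|.
  rewrite ler_normr /=; have [] := (code_itv w, code_itv w').
  case: l l' ll' {IH sw sw'} => [[]|] [[]|] //= _ *; apply/orP;
    first [left; lra|right; lra].
move=> /(le_lt_trans far); rewrite ltNge exprS invfM ler_piMr //.
by rewrite invf_le1 ?exprn_gt0 // exprn_ege1 // ler1n.
Qed.

Definition coded : set R := code @` accepted a.

Lemma code_inj : {in accepted a &, injective code}.
Proof.
move=> w w' /set_mem aw /set_mem aw' ww'.
have := @code_separated (maxn (size w) (size w')) _ _ _ aw aw'.
rewrite ww' subrr normr0 !take_oversize ?leq_maxl ?leq_maxr //; apply.
by rewrite invr_gt0 exprn_gt0.
Qed.

Lemma coded_subitv : coded `<=` `[0, 1].
Proof. by move=> _ [w _ <-]; rewrite /= in_itv /= code_itv. Qed.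

Lemma coded_infinite : infinite_set coded.
Proof.
(* One point is chosen in each block. *)
have /choice[f fP] i : exists w, cylinder a (nseq i zero ++ [:: one]) w.
  apply/cylinder_neq0; exists (Perfect (i.*2 + a i)).
  by rewrite run_cat run_Spine_zeros.
apply: (@sub_infinite_set _ (range (code \o f))).
  by move=> _ [i _ <-]; exists (f i) => //; case: (fP i).
suff inj : {in [set: nat] &, injective (code \o f)}.
  by rewrite (eq_finite_set (inj_card_eq inj)); apply: infinite_nat.
move=> i j _ _ /code_inj fij; apply: (@branch_inj a [::] one _ _ (f i)) => //.
  exact: fP.
rewrite fij; first exact: fP.
- by apply/mem_set; case: (fP i).
- by apply/mem_set; case: (fP j).
Qed.

Lemma coded_discrete : discrete_subset coded.
Proof.
move=> x; have [w aw wx] := set_valP x.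
(* Any coded point in this ball has [w] as a prefix, hence equals it. *)
exists (ball (code w) (6 ^- (size w))); first exact: ball_open.
apply/seteqP; split=> [y|_ ->]; rewrite /preimage /= set_valE; last first.
  by rewrite -wx; apply: ballxx; rewrite invr_gt0 exprn_gt0.
have [w' aw' w'y] := set_valP y; rewrite -w'y => /(code_separated aw aw').
rewrite take_size => ww'; apply: val_inj; rewrite /= -[LHS]w'y -[RHS]wx.
have w'E : w' = w ++ drop (size w) w' by rewrite {1}ww' cat_take_drop.
have d0 : drop (size w) w' = [::] by apply: (accepted_prefix aw); rewrite -w'E.
by rewrite w'E d0 cats0.
Qed.

End Coding.

(** * Uniformly clopen sets as a uniform invariant *)

Section Uniform_clopen.

(** Equivalently, the indicator of [U] is uniformly continuous, since entourages can be inverted. *)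
Definition uniform_clopen (T : uniformType) (U : set T) : Prop :=
  exists2 E, entourage E & forall x y, E (x, y) -> U x -> U y.

Lemma uniform_clopen_preimage (S T : uniformType) (f : S -> T) V :
  unif_continuous f -> uniform_clopen V -> uniform_clopen (f @^-1` V).
Proof.
move=> fu [E entE EV]; exists [set xy | E (f xy.1, f xy.2)].
  exact: fu _ entE.
by move=> x y; apply: EV.
Qed.

Lemma uniform_clopenP (R : realType) (X : set R) (U : set X) :
  uniform_clopen U <->
  exists2 e : R, 0 < e & forall x y : X, `|val x - val y| < e -> U x -> U y.
Proof.
split=> [[E]|[e e0 eU]].
  rewrite -entourage_ballE => -[e /= e0 eE] EU; exists e => // x y xy.
  by apply: EU; apply: eE.
exists [set xy : X * X | `|val xy.1 - val xy.2| < e]; last exact: eU.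
by rewrite -entourage_ballE; exists e.
Qed.

Lemma critical_rank_coded (R : realType) (a : nat -> bool) n :
  critical_rank (@uniform_clopen (@coded R a)) n <->
  nat_of_bool (odd n) = a n./2.
Proof.
rewrite -critical_rankE.
have /choice[f fP] (x : @coded R a) : exists w, accepted a w /\ code w = val x.
  by have [w aw wx] := set_valP x; exists w.
have fK w : accepted a w -> exists x, f x = w.
  move=> aw; have cw : @coded R a (code w) by exists w.
  exists (SigSub (mem_set cw)); have [afw] := fP (SigSub (mem_set cw)).
  exact: (code_inj (mem_set afw) (mem_set aw)).
apply: (@critical_rank_transfer _ _ _ _ f).
- by move=> x y fxy; apply: val_inj; rewrite -(fP x).2 -(fP y).2 fxy.
- move=> U /uniform_clopenP[e e0 eU]; split=> [_ [x _ <-]|].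
    by case: (fP x).
  have [N Ne] : exists N, 6 ^- N < e.
    (* For this [N], [e^-1 < 2 ^ N <= 6 ^ N]. *)
    exists (Num.bound e^-1).
    rewrite -ltf_pV2 ?posrE ?invr_gt0 ?exprn_gt0 // invrK.
    apply: lt_le_trans (upper_nthrootP (leqnn _)) _.
    by apply: lerXn2r; rewrite ?nnegrE ?ler_nat.
  exists N => _ w' [x Ux <-] aw'; have [y <-] := fK w' aw'.
  move=> /(@code_take R); rewrite (fP x).2 (fP y).2 => xy.
  by exists y => //; apply: eU Ux; apply: le_lt_trans Ne.
- move=> V [_ [N NV]]; apply/uniform_clopenP; exists (6 ^- N).
    by rewrite invr_gt0 exprn_gt0.
  move=> x y; have [[ax <-] [ay <-]] := (fP x, fP y).
  by move=> /(code_separated ax ay) xy Vx; apply: NV xy.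
- by move=> V [Va _] w /Va/fK[x <-]; exists x.
Qed.

Lemma metrically_similar_critical_rank (R : realType) (X Y : set R) n :
  metrically_similar X Y -> critical_rank (@uniform_clopen X) n ->
  critical_rank (@uniform_clopen Y) n.
Proof.
move=> [f [g [fK gK fu gu]]].
apply: (critical_rank_transfer (can_inj fK) _ _ _ n).1.
(* The image under [f] is the preimage under [g]. *)
- move=> U /(uniform_clopen_preimage gu); congr uniform_clopen.
  apply/seteqP; split=> [y Ugy|_ [x Ux <-]]; last by rewrite /preimage /= fK.
  by exists (g y).
- by move=> V; apply: uniform_clopen_preimage.
- by move=> V _ y _; exists (g y).
Qed.

End Uniform_clopen.

(** * Cuts in the rationals and the family indexed by the reals *)

Definition rational_cut (R : realType) (r : R) (k : nat) : bool :=
  (* Numbers that code no rational get the default [false]. *)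
  if unpickle k is Some q then ratr q < r else false.

Lemma rational_cut_inj (R : realType) : injective (@rational_cut R).
Proof.
move=> r r'; wlog rr' : r r' / r < r' => [H rE|].
  by have [/H->|/H->|] := ltgtP r r'.
have [q] := rat_in_itvoo rr'; rewrite in_itv /= => /andP[rq qr'].
move/(congr1 (@^~ (pickle q))); rewrite /rational_cut pickleK qr'.
by rewrite ltNge (ltW rq).
Qed.

Theorem theorem5 (R : realType) :
  exists F : set (set R),
    [/\ (F #= [set: R])%card,
        forall X : set R, F X ->
          [/\ X `<=` `[0, 1], infinite_set X & discrete_subset X]
      & forall X Y : set R, F X -> F Y -> X <> Y -> metrically_distinct X Y].
Proof.
pose X (r : R) := @coded R (rational_cut r).
(* One inclusion suffices: exactly one of [2 k] and [2 k + 1] is critical for each set. *)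
have cut r r' : (forall n, critical_rank (@uniform_clopen (X r)) n ->
    critical_rank (@uniform_clopen (X r')) n) -> r = r'.
  move=> rr'; apply/rational_cut_inj/funext => k.
  have := rr' (k.*2 + rational_cut r k)%N; rewrite !critical_rank_coded.
  have -> (b : bool) : (k.*2 + b)./2%N = k by case: b; lia.
  rewrite oddD odd_double oddb.
  by case: (rational_cut r k); case: (rational_cut r' k) => //= /(_ erefl).
exists (range X); split.
- by apply: inj_card_eq => r r' _ _ XX; apply: cut; rewrite XX.
- move=> _ [r _ <-]; split.
  + exact: coded_subitv.
  + exact: coded_infinite.
  + exact: coded_discrete.
- move=> _ _ [r _ <-] [r' _ <-] XX sim; apply: XX; congr X; apply: cut => n.
  exact: metrically_similar_critical_rank.
Qed.
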